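(* Let $G$ be a non-complete graph with a universal vertex $v$ (i.e. $v$ is adjacent to all other vertices). Suppose that $G-v$ has $q$ components, of which $p$ are trivial (single vertices). (a) If $q\ge 3$, then $rc(G)=rc^\ell(G)=\max(p,3)$. (b) If $q\in\{1,2\}$, then $2\le rc(G)\le rc^\ell(G)\le 3$.
   Context: All graphs are finite, simple and undirected. An edge-coloured path is rainbow if all its edges have distinct colours. An (not necessarily proper) edge-colouring of a connected graph $G$ is rainbow connected if any two vertices are joined by a rainbow path; $rc(G)$ is the minimum number of colours in a rainbow connected edge-colouring of $G$. An $r$-edge-list assignment of $G$ assigns to each edge $e$ a set $L(e)\subset\mathbb N$ with $|L(e)|\ge r$; an $L$-edge-colouring is an edge-colouring $c$ with $c(e)\in L(e)$ for all $e$. $rc^\ell(G)$ is the minimum integer $r$ such that for every $r$-edge-list assignment $L$ of $G$ there exists a rainbow connected $L$-edge-colouring of $G$. *)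

(* Defs.v *)
From mathcomp Require Import all_boot.
From mathcomp Require Import boolp classical_sets functions cardinality.

Set Implicit Arguments.
Unset Strict Implicit.
Unset Printing Implicit Defensive.

Record sgraph := SGraph {
  vertex :> finType;
  adj : rel vertex;
  adj_sym : symmetric adj;
  adj_irrefl : irreflexive adj }.

Section Graphs.
Variable G : sgraph.

Definition complete : Prop := forall x y : G, x != y -> adj x y.

Definition universal (v : G) : Prop := forall x : G, x != v -> adj v x.

Definition edges : {set {set G}} :=
  [set [set xy.1; xy.2] | xy : G * G & adj xy.1 xy.2].

Definition components : {set {set G}} :=
  [set [set y | connect (@adj G) x y] | x : G].

Definition trivial_components : {set {set G}} :=
  [set C in components | #|C| == 1].

(* [x :: s] is the vertex sequence of a path, [pairmap] lists its edges. *)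
Definition rainbow_path (c : {set G} -> nat) (x : G) (s : seq G) : bool :=
  [&& path (@adj G) x s, uniq (x :: s)
    & uniq [seq c A | A <- pairmap (fun a b => [set a; b]) x s]].

(* A colouring is a total function on vertex sets, of which only the values on
   [edges] matter. *)
Definition rainbow_connected (c : {set G} -> nat) : Prop :=
  forall x y : G, exists s : seq G, rainbow_path c x s /\ last x s = y.

Definition num_colours (c : {set G} -> nat) : nat :=
  size (undup [seq c A | A <- enum edges]).

Definition edge_list_assignment (r : nat) (L : {set G} -> set nat) : Prop :=
  forall A, A \in edges -> (`I_r #<= L A)%classic%card.

Definition list_colouring (L : {set G} -> set nat) (c : {set G} -> nat) : Prop :=
  forall A, A \in edges -> L A (c A).

End Graphs.

Definition is_minimum (P : nat -> Prop) (n : nat) : Prop :=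
  P n /\ forall m, P m -> n <= m.

(* [is_rc G k] and [is_rcl G k] say that rc(G) = k and that rc^l(G) = k; neither
   holds for any [k] when [G] is disconnected. *)
Definition is_rc (G : sgraph) : nat -> Prop :=
  is_minimum (fun k => exists c : {set G} -> nat,
    rainbow_connected c /\ num_colours c = k).

Definition is_rcl (G : sgraph) : nat -> Prop :=
  is_minimum (fun r => forall L : {set G} -> set nat,
    edge_list_assignment r L ->
    exists c, list_colouring L c /\ rainbow_connected c).

Section DeleteVertex.
Variables (G : sgraph) (v : G).

Definition del_adj : rel {x : G | x != v} := fun x y => adj (val x) (val y).

Lemma del_adj_sym : symmetric del_adj.
Proof. by move=> x y; apply: adj_sym. Qed.

Lemma del_adj_irrefl : irreflexive del_adj.
Proof. by move=> x; apply: adj_irrefl. Qed.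

Definition del_vertex : sgraph := SGraph del_adj_sym del_adj_irrefl.

End DeleteVertex.

(* Main.v *)
(* Colour the star at [v] so that the pendant edges get distinct colours and
   every other vertex has a neighbour in [G - v] whose star edge is coloured
   differently; then colour each edge [xy] of [G - v] differently from [vx] and
   [vy]. Two vertices whose star edges differ are joined through [v]; if the star
   edges of [x] and [y] agree then one of them, say [x], is not pendant, and a
   detour through a neighbour of [x] with another star colour gives a rainbow
   path with three edges. Conversely, distinct pendant edges need distinct
   colours, and with only two colours vertices in different components of
   [G - v] can only be joined through [v]. *)
Require Import Defs.
From mathcomp Require Import boolp classical_sets cardinality.
From mathcomp Require Import all_boot.

Set Implicit Arguments.
Unset Strict Implicit.
Unset Printing Implicit Defensive.

(** * Minima, cardinality bounds and choices from lists *)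

Lemma is_minimum_exists (P : nat -> Prop) (n : nat) :
  P n -> exists m, is_minimum P m.
Proof.
move=> Pn.
have exP : exists m, `[< P m >] by exists n; apply/asboolP.
case: (ex_minnP exP) => m /asboolP Pm minm.
by exists m; split=> // k Pk; apply/minm/asboolP.
Qed.

Lemma card_le_seq (T : eqType) (x0 : T) (s : seq T) :
  ([set` s] #<= `I_(size s))%classic%card.
Proof.
apply: card_le_trans (card_image_le (nth x0 s) _).
apply: subset_card_le => x /= xs.
by exists (index x s); rewrite /= ?index_mem ?nth_index.
Qed.

Lemma card_le_avoid (r : nat) (S : set nat) (s : seq nat) :
  (`I_r #<= S)%classic%card -> size s < r -> exists2 a, S a & a \notin s.
Proof.
move=> rS lt_sr; apply: contrapT => noa.
have Ss : (S `<=` [set` s])%classic.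
  by move=> a Sa; apply: contrapT => /negP as_; apply: noa; exists a.
have := card_le_trans rS (card_le_trans (subset_card_le Ss) (card_le_seq 0 s)).
by rewrite card_le_II leqNgt lt_sr.
Qed.

(** A greedy choice works: each list on [I] is longer than the number of colours already used on
    [I]. *)
Lemma list_system_injective (T : finType) (L : T -> set nat) (I : seq T) :
  (forall x, exists a, L x a) -> uniq I ->
  {in I, forall x, (`I_(size I) #<= L x)%classic%card} ->
  exists2 f : T -> nat, (forall x, L x (f x)) & {in I &, injective f}.
Proof.
move=> L0 uI LI.
have [f0 f0L] := choice L0.
(* The list size becomes any [n] with [size I <= n], so that [I] can shrink in the induction while
   the lists stay the same. *)
move: {-1}(size I) (leqnn (size I)) LI => n.
elim: I uI => [_ _ _|x I IH /=].
  by exists f0.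
move=> /andP[xI uI] lt_n LI.
have [|f fL finj] := IH uI (ltnW lt_n).
  by move=> y yI; apply: LI; rewrite inE yI orbT.
have [|a La aI] := card_le_avoid (s := map f I) (LI x (mem_head _ _)).
  by rewrite size_map.
exists (fun y => if y == x then a else f y).
  by move=> y; case: eqP => [->|].
move=> y z; rewrite !inE.
have [->|yx] := eqVneq y x; have [->|zx] := eqVneq z x => //=.
- by move=> _ zI def_a; rewrite def_a map_f in aI.
- by move=> yI _ def_a; rewrite -def_a map_f in aI.
by move=> yI zI; apply: finj.
Qed.

Lemma set2_injr (T : finType) (x y z : T) : [set z; x] = [set z; y] -> x = y.
Proof.
move/setP => eqs.
have := eqs x; have := eqs y; rewrite !inE !eqxx !orbT.
by move=> /orP[/eqP ->|/eqP ->] // /esym/orP[] /eqP ->.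
Qed.

(** * Edges, numbers of colours and isolated vertices *)

Section GraphLemmas.
Variable G : sgraph.
Implicit Types (x y z : G) (c : {set G} -> nat).

Lemma mem_edges x y : adj x y -> [set x; y] \in edges G.
Proof. by move=> xy; apply/imsetP; exists (x, y) => //; rewrite inE. Qed.

Lemma edgesP A :
  reflect (exists x y, adj x y /\ A = [set x; y]) (A \in edges G).
Proof.
apply: (iffP imsetP) => [[[x y]]|[x [y [xy ->]]]].
  by rewrite inE => xy ->; exists x, y.
by exists (x, y) => //; rewrite inE.
Qed.

Lemma path_edges x s :
  path (@adj G) x s ->
  {subset pairmap (fun a b => [set a; b]) x s <= edges G}.
Proof.
elim: s x => [|y s IH] x //= /andP[xy ps] A.
by rewrite inE => /orP[/eqP->|/IH]; [apply: mem_edges|apply].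
Qed.

Lemma uniq_colours_leq c (s : seq nat) :
  uniq s -> {subset s <= [seq c A | A <- enum (edges G)]} ->
  size s <= num_colours c.
Proof.
by move=> us sub; apply: uniq_leq_size => // a /sub; rewrite mem_undup.
Qed.

Lemma rainbow_path_size c x s : rainbow_path c x s -> size s <= num_colours c.
Proof.
move=> /and3P[ps _ us].
rewrite -(size_pairmap (fun a b => [set a; b]) x s) -(size_map c).
apply: uniq_colours_leq => // _ /mapP[A As ->].
by apply: map_f; rewrite mem_enum (path_edges ps).
Qed.

Lemma num_colours_leq c r :
  {in edges G, forall A, c A < r} -> num_colours c <= r.
Proof.
move=> ltr; rewrite -(size_iota 0 r).
apply: uniq_leq_size; first exact: undup_uniq.
move=> a; rewrite mem_undup => /mapP[A]; rewrite mem_enum => /ltr ? ->.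
by rewrite mem_iota.
Qed.

(** With at most one colour a rainbow path has at most one edge, so any two distinct vertices would
    be adjacent. *)
Lemma noncomplete_num_colours_gt1 c :
  ~ complete G -> rainbow_connected c -> 1 < num_colours c.
Proof.
move=> ncG rc; rewrite ltnNge; apply/negP => le1; apply: ncG => x y xy.
have [s [rs sy]] := rc x y.
have := leq_trans (rainbow_path_size rs) le1.
case: s rs sy => [|z [|? ?]] //=; first by move=> _ /eqP; rewrite (negPf xy).
by case/and3P=> /= /andP[xz _] _ _ <-.
Qed.

(** Representatives of the trivial components; in [G - v] their star edges are the pendant edges of
    [G]. *)
Definition isolated : {set G} := [set x | [forall y, ~~ adj x y]].

Lemma isolatedP x : reflect (forall y, ~~ adj x y) (x \in isolated).
Proof. by rewrite inE; apply: forallP. Qed.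

Lemma trivial_componentsE :
  trivial_components G = [set [set x] | x in isolated].
Proof.
apply/setP => C; apply/setIdP/imsetP.
  case=> /imsetP[x _ defC] /cards1P[z Cz].
  have xC : x = z by apply/set1P; rewrite -Cz defC inE connect0.
  exists x; last by rewrite Cz xC.
  apply/isolatedP => y; apply/negP => xy.
  have : y \in C by rewrite defC inE connect1.
  by rewrite Cz -xC inE => /eqP yx; rewrite yx adj_irrefl in xy.
case=> x /isolatedP isox ->; rewrite cards1; split=> //.
apply/imsetP; exists x => //; apply/setP => y; rewrite !inE.
apply/eqP/connectP => [->|[[|z s] /=]]; first by exists [::].
  by move=> _ ->.
by rewrite (negPf (isox z)).
Qed.

Lemma card_isolated : #|isolated| = #|trivial_components G|.
Proof. by rewrite trivial_componentsE card_imset //; apply: set1_inj. Qed.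

(* A vertex all of whose neighbours share its colour can be recoloured: this
   makes it and its neighbours good and affects no other vertex. *)
Lemma list_colouring_vary_neighbour (L : G -> set nat) :
  (forall x, `I_2 #<= L x)%classic%card ->
  {in isolated, forall x, (`I_#|isolated| #<= L x)%classic%card} ->
  exists f : G -> nat,
    [/\ forall x, L x (f x), {in isolated &, injective f}
      & forall x, x \notin isolated -> exists2 y, adj x y & f x != f y].
Proof.
move=> L2 LI.
have L0 x : exists a, L x a.
  by have [//|a La _] := card_le_avoid (s := [::]) (L2 x); exists a.
have [||f fL finj] := list_system_injective (I := enum isolated) L0.
- exact: enum_uniq.
- by move=> x; rewrite mem_enum -cardE => /LI.
have {}finj : {in isolated &, injective f}.
  by move=> x y xI yI; apply: finj; rewrite mem_enum.
(* The induction is on the number of bad vertices: non-isolated ones whose neighbours all share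
   their colour. *)
pose bad (g : G -> nat) :=
  [set x | (x \notin isolated) && [forall y, adj x y ==> (g x == g y)]].
have [n] := ubnP #|bad f|.
elim: n f fL finj => // n IH f fL finj lt_n.
have [bad0|[x xbad]] := set_0Vmem (bad f).
  exists f; split=> // x xI.
  have : x \notin bad f by rewrite bad0 in_set0.
  rewrite inE xI /= => /forallPn[y].
  by rewrite negb_imply => /andP[xy fxy]; exists y.
have := xbad; rewrite inE => /andP[xI /forallP xsame].
have {}xsame y : adj x y -> f y = f x.
  by move=> xy; have := xsame y; rewrite xy => /eqP.
have [//|a La] := card_le_avoid (s := [:: f x]) (L2 x).
rewrite inE => afx.
pose g y := if y == x then a else f y.
apply: (IH g).
- by move=> y; rewrite /g; case: eqP => [->|].
(* The recoloured [x] is not isolated, so injectivity on isolated vertices is untouched. *)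
- move=> y z yI zI; rewrite /g.
  have /negPf -> : y != x by apply: contraNneq xI => <-.
  have /negPf -> : z != x by apply: contraNneq xI => <-.
  exact: finj.
- rewrite ltnS in lt_n; apply: leq_trans lt_n; apply: proper_card.
  have gx : g x = a by rewrite /g eqxx.
  (* Some neighbour of [x] exists and keeps the old colour [f x], which differs from [a]. *)
  have xgood : x \notin bad g.
    rewrite inE xI /=; move: xI; rewrite inE => /forallPn[y /negPn xy].
    apply/forallPn; exists y; rewrite negb_imply xy gx /g.
    have /negPf-> : y != x by apply: contraTneq xy => ->; rewrite adj_irrefl.
    by rewrite (xsame y).
  apply/properP; split; last by exists x.
  (* No vertex turns bad: a neighbour of [x] has colour [f x] and now sees [a], while all others see
     the same colours as before. *)
  apply/subsetP => y ybad; have yx : y != x by apply: contraNneq xgood => <-.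
  move: ybad; rewrite !inE => /andP[-> /forallP ysame] /=.
  apply/forallP => z; apply/implyP => yz.
  have := ysame z; rewrite yz /g (negPf yx) /=; have [zx|//] := eqVneq z x.
  rewrite zx adj_sym in yz.
  by rewrite (xsame _ yz) eq_sym (negPf afx).
Qed.

End GraphLemmas.

(** * Lower bounds from the colours of the star at the universal vertex *)

Section UniversalVertex.
Variables (G : sgraph) (v : G).
Hypothesis hv : universal v.
Local Notation H := (del_vertex v).
Implicit Types (x y z : H) (c : {set G} -> nat).

Lemma star_edge x : [set v; val x] \in edges G.
Proof. exact/mem_edges/hv/(valP x). Qed.

Lemma val_neq x y : (val x != val y) = (x != y).
Proof. by rewrite (inj_eq val_inj). Qed.

(** The only neighbour of such a vertex in [G] is [v], so a rainbow path between two of them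
    contains both pendant edges. *)
Lemma isolated_star_colour_inj c :
  rainbow_connected c ->
  {in isolated H &, injective (fun x => c [set v; val x])}.
Proof.
move=> rc x y /isolatedP xI /isolatedP yI /= eqc.
have nbr_v z (u : G) : (forall t, ~~ adj z t) -> adj (val z) u -> u = v.
  move=> zI zu; apply/eqP; apply: contraT => uv.
  by have := zI (Sub u uv); rewrite /adj /= /del_adj SubK zu.
apply/eqP; apply: contraT => xy.
have [s [/and3P[ps us ucs] sy]] := rc (val x) (val y).
have mem1 : [set v; val x] \in pairmap (fun a b => [set a; b]) (val x) s.
  case: s ps sy {us ucs} => [_ /eqP|u s /= /andP[xu _] _].
    by rewrite /= (negPf (_ : val x != val y)) // val_neq.
  by rewrite (nbr_v _ _ xI xu) setUC mem_head.
have mem2 : [set v; val y] \in pairmap (fun a b => [set a; b]) (val x) s.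
  case/lastP: s ps sy {us ucs mem1} => [_ /eqP|s u].
    by rewrite /= (negPf (_ : val x != val y)) // val_neq.
  rewrite last_rcons rcons_path => /andP[_ su] uy; subst u.
  rewrite adj_sym in su.
  by rewrite -cats1 pairmap_cat mem_cat /= inE (nbr_v _ _ yI su) eqxx orbT.
(* On the edges of a rainbow path [c] is injective, so equal colours would identify the two pendant
   edges. *)
have cinj : {in pairmap (fun a b => [set a; b]) (val x) s &, injective c}.
  move=> A B As Bs eqAB.
  have := nth_index set0 As; have := nth_index set0 Bs.
  move: (As) (Bs); rewrite -!index_mem => ltA ltB <- <-; congr nth.
  apply/eqP; rewrite -(nth_uniq 0 _ _ ucs) ?size_map //.
  by rewrite !(nth_map set0) // !nth_index // eqAB.
by have := set2_injr (cinj _ _ mem1 mem2 eqc) => /val_inj/eqP; rewrite (negPf xy).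
Qed.

Lemma isolated_leq_num_colours c :
  rainbow_connected c -> #|trivial_components H| <= num_colours c.
Proof.
move=> rc; rewrite -card_isolated cardE.
rewrite -(size_map (fun x => c [set v; val x])).
apply: uniq_colours_leq.
  rewrite map_inj_in_uniq ?enum_uniq // => x y.
  by rewrite !mem_enum; apply: isolated_star_colour_inj.
by move=> _ /mapP[x _ ->]; apply: map_f; rewrite mem_enum star_edge.
Qed.

(** A rainbow path now has at most two edges, and it must leave the component of [x] through [v];
    hence it consists of the two star edges. *)
Lemma unconnected_star_colour_neq c x y :
  rainbow_connected c -> num_colours c < 3 -> ~~ connect (@adj H) x y ->
  c [set v; val x] != c [set v; val y].
Proof.
move=> rc lt3 nxy.
have [s [rs sy]] := rc (val x) (val y).
have := leq_ltn_trans (rainbow_path_size rs) lt3.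
case: s rs sy => [|z [|t [|? ?]]] //=.
- by move=> _ /val_inj xy; rewrite xy connect0 in nxy.
- case/and3P=> /= /andP[xz _] _ _ zy; rewrite zy in xz.
  by rewrite connect1 in nxy.
case/and3P=> /= /and3P[xz zt _] _; rewrite inE andbT => cc ty _; subst t.
have [zv|zv] := eqVneq z v; first by rewrite zv (setUC [set val x]) in cc.
case/negP: nxy.
by apply: (@connect_trans _ _ (Sub z zv : H)); apply: connect1.
Qed.

Lemma three_components_num_colours c :
  rainbow_connected c -> 3 <= #|components H| -> 3 <= num_colours c.
Proof.
move=> rc /card_gt2P[C1 [C2 [C3 [[m1 m2 m3] [d12 d23 d31]]]]].
(* Having fewer than three colours forces star edges to different components to differ in colour,
   and three components then yield three colours. *)
rewrite leqNgt; apply/negP => lt3.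
have star (x y : H) : [set t | connect (@adj H) x t] != [set t | connect (@adj H) y t] ->
    c [set v; val x] != c [set v; val y].
  move=> neq; apply: unconnected_star_colour_neq => //.
  apply: contra neq => xy; apply/eqP/setP => t; rewrite !inE.
  exact: (same_connect (sym_connect_sym (@adj_sym H)) xy).
case/imsetP: m1 d12 d31 => x1 _ -> d12 d31.
case/imsetP: m2 d12 d23 => x2 _ -> d12 d23.
case/imsetP: m3 d23 d31 => x3 _ -> d23 d31.
suff : 3 <= num_colours c by rewrite leqNgt lt3.
pose s := [:: c [set v; val x1]; c [set v; val x2]; c [set v; val x3]].
apply: (@uniq_colours_leq G c s).
  by rewrite /= !inE !negb_or (star _ _ d12) (star _ _ d23) eq_sym (star _ _ d31).
by move=> a; rewrite !inE => /or3P[] /eqP->; apply: map_f; rewrite mem_enum star_edge.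
Qed.

(** * Rainbow connected colourings built from the star *)

Lemma star_colouring_rainbow_connected c :
  {in isolated H &, injective (fun x => c [set v; val x])} ->
  (forall x, x \notin isolated H ->
    exists2 y, adj x y & c [set v; val x] != c [set v; val y]) ->
  (forall x y, adj x y -> c [set val x; val y] != c [set v; val x]) ->
  rainbow_connected c.
Proof.
move=> cinj cvary cedge.
(* On the path [x], [z], [v], [y] the last edge has the colour of [vx], hence differs from [vz] and
   from [xz]. The reverse path serves the case where only the end vertex is not isolated. *)
have detour x y : x != y -> x \notin isolated H ->
    c [set v; val x] = c [set v; val y] ->
    exists z, rainbow_path c (val x) [:: val z; v; val y] /\
              rainbow_path c (val y) [:: v; val z; val x].
  move=> xy xI eqc; have [z xz cxz] := cvary x xI.
  have zx : z != x by apply: contraNneq cxz => ->.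
  have zy : z != y by apply: contraNneq cxz => ->; apply/eqP.
  have xzG : adj (val x) (val z) := xz.
  have zxG : adj (val z) (val x) by rewrite adj_sym.
  have c1 := cedge _ _ xz.
  (* [cedge] speaks of the first end only; reading the edge backwards gives the other. *)
  have c2 : c [set val x; val z] != c [set v; val z] by rewrite setUC cedge.
  have xv := valP x; have yv := valP y; have zv := valP z.
  exists z; rewrite /rainbow_path /= !inE !negb_or !andbT.
  rewrite xzG zxG !(adj_sym _ v) !hv //= !val_neq.
  rewrite (setUC [set val z] [set v]) (setUC [set val y] [set v]).
  rewrite (setUC [set val z] [set val x]) -eqc !(eq_sym v) xv yv zv.
  rewrite (eq_sym x z) !(eq_sym y) xy zx zy c1 c2 cxz.
  by rewrite !(eq_sym _ (c [set val x; val z])) c1 c2 eq_sym cxz.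
move=> a b; have [<-|ab] := eqVneq a b; first by exists [::].
have direct : adj a b -> exists s, rainbow_path c a s /\ last a s = b.
  by move=> ad; exists [:: b]; rewrite /rainbow_path /= inE ab ad.
have [av|av] := eqVneq a v.
  by apply: direct; rewrite av hv // -av eq_sym.
have [bv|bv] := eqVneq b v; first by apply: direct; rewrite bv adj_sym hv.
pose x : H := Sub a av; pose y : H := Sub b bv.
have xy : x != y by rewrite -val_neq.
have [eqc|neqc] := eqVneq (c [set v; a]) (c [set v; b]); last first.
  exists [:: v; b]; rewrite /rainbow_path /= !inE negb_or ab av (eq_sym v b) bv.
  by rewrite (adj_sym a) !hv //= setUC neqc.
have [xI|xI] := boolP (x \in isolated H); last first.
  by have [z [rp _]] := detour x y xy xI eqc; exists [:: val z; v; b].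
have [yI|yI] := boolP (y \in isolated H).
  by have /eqP := cinj x y xI yI eqc; rewrite (negPf xy).
have [z [_ rp]] := detour y x (contra_neq esym xy) yI (esym eqc).
by exists [:: v; val z; b].
Qed.

(** The star is coloured first. Every other edge then has two star colours to avoid, for which three
    colours in its list suffice. *)
Lemma list_rainbow_connected (r : nat) (L : {set G} -> set nat) :
  3 <= r -> #|trivial_components H| <= r -> edge_list_assignment r L ->
  exists c, list_colouring L c /\ rainbow_connected c.
Proof.
move=> r3 rp Lr.
have Lle k A : k <= r -> A \in edges G -> (`I_k #<= L A)%classic%card.
  by move=> kr /Lr; apply: card_le_trans; rewrite card_le_II.
have [||f [fL finj fvary]] :=
    @list_colouring_vary_neighbour H (fun x => L [set v; val x]).
- by move=> x; apply: Lle (star_edge x); apply: ltnW.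
- by move=> x _; apply: Lle (star_edge x); rewrite card_isolated.
(* The demands are stated edge by edge so that choice assembles the colouring. The last clause
   covers both orders of the ends, hence both star colours; off the edges the value 0 is
   arbitrary. *)
have : forall A, exists a, A \in edges G ->
    [/\ L A a, forall x, A = [set v; val x] -> a = f x
      & forall x y, A = [set val x; val y] -> a != f x].
  move=> A; have [AE|] := boolP (A \in edges G); last by exists 0.
  have [vA|vA] := boolP (v \in A).
    have [x defA] : exists x : H, A = [set v; val x].
      case/edgesP: AE vA => a [b [ab ->]]; rewrite !inE => /orP[] /eqP va.
        have bv : b != v by apply: contraTneq ab => ->; rewrite va adj_irrefl.
        by exists (Sub b bv); rewrite SubK -va.
      have av : a != v by apply: contraTneq ab => ->; rewrite va adj_irrefl.
      by exists (Sub a av); rewrite SubK -va setUC.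
    exists (f x) => _; split; first by rewrite defA.
      by move=> y; rewrite defA => /set2_injr/val_inj->.
    move=> y z defA'; move: vA; rewrite defA' !inE.
    by rewrite !(eq_sym v) (negPf (valP y)) (negPf (valP z)).
  have [x [y defA]] : exists x y : H, A = [set val x; val y].
    case/edgesP: AE vA => a [b [ab ->]]; rewrite !inE negb_or !(eq_sym v).
    by case/andP=> av bv; exists (Sub a av), (Sub b bv).
  have [|a La] := card_le_avoid (s := [:: f x; f y]) (Lr A AE).
    exact: r3.
  rewrite !inE negb_or => /andP[ax ay].
  exists a => _; split=> // [z defA'|z t defA'].
    by rewrite defA' !inE eqxx in vA.
  have : val z \in A by rewrite defA' !inE eqxx.
  by rewrite defA !inE => /orP[] /eqP/val_inj->.
case/choice => c cP; exists c; split; first by move=> A /cP[].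
have cstar x : c [set v; val x] = f x.
  by have [_ /(_ x erefl)] := cP _ (star_edge x).
apply: star_colouring_rainbow_connected.
- by move=> x y xI yI; rewrite !cstar; apply: finj.
- by move=> x /fvary[y xy fxy]; exists y => //; rewrite !cstar.
move=> x y xy; rewrite cstar.
have /cP[_ _] : [set val x; val y] \in edges G by apply: mem_edges.
by apply.
Qed.

End UniversalVertex.

(** * Comparison of the two numbers and the final bounds *)

Lemma constant_list_colouring (G : sgraph) (r : nat) :
  (forall L : {set G} -> set nat, edge_list_assignment r L ->
     exists c, list_colouring L c /\ rainbow_connected c) ->
  exists2 c : {set G} -> nat, rainbow_connected c & num_colours c <= r.
Proof.
case/(_ (fun=> `I_r)%classic) => [A _|c [cL rc]]; first exact: card_lexx.
by exists c => //; apply: num_colours_leq.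
Qed.

Theorem theorem2p3 (G : sgraph) (v : G) (p q : nat)
    (hG : ~ complete G) (hv : universal v)
    (hq : #|components (del_vertex v)| = q)
    (hp : #|trivial_components (del_vertex v)| = p) :
  (3 <= q -> is_rc G (maxn p 3) /\ is_rcl G (maxn p 3)) /\
  (q = 1 \/ q = 2 ->
     exists k l : nat, [/\ is_rc G k, is_rcl G l & [&& 2 <= k, k <= l & l <= 3]]).
Proof.
have upper r : 3 <= r -> p <= r -> forall L : {set G} -> set nat,
    edge_list_assignment r L -> exists c, list_colouring L c /\ rainbow_connected c.
  by move=> r3 pr L; apply: (list_rainbow_connected hv); rewrite ?hp.
split=> [q3|q12].
  have lower (c : {set G} -> nat) : rainbow_connected c -> maxn p 3 <= num_colours c.
    move=> rc; rewrite geq_max -hp (isolated_leq_num_colours hv) //.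
    by rewrite (three_components_num_colours hv) ?hq.
  have upm := upper _ (leq_maxr p 3) (leq_maxl p 3).
  split; split=> //.
  (* Constant lists give at most [maxn p 3] colours, and [lower] turns this into the exact number
     that [is_rc] asks for. *)
  - have [c rc cle] := constant_list_colouring upm.
    by exists c; split=> //; apply/eqP; rewrite eqn_leq cle lower.
  - by move=> m [c [rc <-]]; apply: lower.
  - by move=> m /constant_list_colouring[c /lower]; apply: leq_trans.
(* Trivial components are components, so [p <= q <= 2] and lists of size 3 suffice. *)
have p3 : p <= 3.
  apply: (@leq_trans q); last by case: q12 => ->.
  by rewrite -hp -hq; apply/subset_leq_card/subsetP => C /setIdP[].
have up3 := upper 3 (leqnn 3) p3.
have [l [lP lmin]] : exists l, is_rcl G l by apply: (@is_minimum_exists _ 3).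
(* Constant lists of the optimal size [l] give a colouring that shows both that rc exists and that
   it is at most [l]. *)
have [c rc cle] := constant_list_colouring lP.
have [k [[d [rd dk]] kmin]] : exists k, is_rc G k.
  by apply: (@is_minimum_exists _ (num_colours c)); exists c.
exists k, l; split; try by split=> //; exists d.
apply/and3P; split; last exact: lmin.
  by rewrite -dk noncomplete_num_colours_gt1.
by apply: leq_trans cle; apply: kmin; exists c.
Qed.
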